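(* Assume the Generalized Continuum Hypothesis (GCH). Let $\kappa$ be an uncountable cardinal and let $I=\{\lambda\leq\kappa : \lambda \text{ is a regular cardinal}\}$. Let $G$ be a $\kappa$-existentially closed group of cardinality $\kappa$. Then $G$ has a chain $\{G_\lambda\}_{\lambda\in I}$ of subgroups $$\langle 1\rangle < G_{\aleph_0} < G_{\aleph_1} < \cdots < G_\lambda < \cdots$$ with $G=\bigcup_{\lambda\in I} G_\lambda$, such that for every regular cardinal $\lambda\leq\kappa$ the subgroup $G_\lambda$ is a $\lambda$-existentially closed group of cardinality $\lambda$, and $G_\kappa=G$.
   Context: For an infinite cardinal $\kappa$, a group $G$ is called $\kappa$-existentially closed if every system of fewer than $\kappa$ many equations and inequations with coefficients from $G$ which has a solution in some overgroup $H\geq G$ already has a solution in $G$. *)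

(* Defs.v *)
From HB Require Import structures.
From mathcomp Require Import all_boot.
From mathcomp Require Import boolp classical_sets functions cardinality.

Set Implicit Arguments.
Unset Strict Implicit.
Unset Printing Implicit Defensive.

Local Open Scope classical_set_scope.
Local Open Scope card_scope.

(* Following cardinality.v, cardinals are handled relationally: a cardinal is
   represented by any type L of that size, the comparisons are those of the
   sets [set: L], and equality of cardinals is #= (not =). *)
Definition cardinal := Type.

Reserved Notation "A '#<' B" (at level 79, format "A  '#<'  B").

Definition card_lt T U (A : set T) (B : set U) : bool :=
  (A #<= B) && ~~ (B #<= A).
Notation "A '#<' B" := (card_lt A B) : card_scope.

(* No cardinal lies strictly between an infinite cardinal and its power. *)
Definition GCH : Prop := forall L M : cardinal,
  infinite_set [set: L] ->
  ~ ([set: L] #< [set: M] /\ [set: M] #< [set: set L]).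

(* An infinite cardinal that is not a union of fewer than L sets, each of
   cardinality less than L. *)
Definition regular_cardinal (L : cardinal) : Prop :=
  infinite_set [set: L] /\
  forall (J : cardinal) (F : J -> set L),
    [set: J] #< [set: L] -> (forall j, F j #< [set: L]) ->
    \bigcup_(j in [set: J]) F j <> [set: L].

(* Group words in the variables X with coefficients in G; they denote the
   elements of the free product of G with the free group on X. *)
Inductive gword (G X : Type) : Type :=
  | GConst of G
  | GVar of X
  | GMul of gword G X & gword G X
  | GInv of gword G X.

Arguments GVar {G X}.

Fixpoint gword_eval (G : Type) (H : groupType) (f : G -> H)
    (X : Type) (v : X -> H) (w : gword G X) : H :=
  match w with
  | GConst g => f g
  | GVar x => v x
  | GMul w1 w2 => (gword_eval f v w1 * gword_eval f v w2)%g
  | GInv w1 => (gword_eval f v w1)^-1%g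
  end.

Variant condition (G X : Type) : Type :=
  | Equation of gword G X & gword G X
  | Inequation of gword G X & gword G X.

Definition satisfies (G : Type) (H : groupType) (f : G -> H)
    (X : Type) (v : X -> H) (c : condition G X) : Prop :=
  match c with
  | Equation w1 w2 => gword_eval f v w1 = gword_eval f v w2
  | Inequation w1 w2 => gword_eval f v w1 <> gword_eval f v w2
  end.

(* The system S is solvable in H, its coefficients being sent to H by f. *)
Definition solvable_in (G : Type) (H : groupType) (f : G -> H)
    (X : Type) (S : set (condition G X)) : Prop :=
  exists v : X -> H, forall c, S c -> satisfies f v c.

(* An overgroup of G is a group H with an injective morphism G -> H. The set X
   of variables is arbitrary, as each condition mentions finitely many of them.
   The notion is meant for infinite K. *)
Definition existentially_closed (K : cardinal) (G : groupType) : Prop :=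
  forall (X : Type) (S : set (condition G X)),
    S #< [set: K] ->
    (exists (H : groupType) (f : {multiplicative G -> H}),
        injective f /\ solvable_in f S) ->
    solvable_in (@id G) S.

Definition subgroup_type (G : groupType) (S : groupClosed G) : Type :=
  {x : G | x \in S}.

Section SubgroupType.
Variables (G : groupType) (S : groupClosed G).

HB.instance Definition _ := SubType.copy (subgroup_type S) {x : G | x \in S}.
HB.instance Definition _ := [Choice of subgroup_type S by <:].

Fact subgroup_closed : group_closed (fun x : G => x \in S).
Proof. by split=> [|x y]; [exact: gpred1|exact: gpredF]. Qed.

HB.instance Definition _ :=
  SubChoice_isSubGroup.Build G (fun x : G => x \in S) (subgroup_type S)
    subgroup_closed.

End SubgroupType.

(* Main.v *)
Require Import Defs.
From Stdlib Require Import Wellfounded.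
From HB Require Import structures.
From mathcomp Require Import all_boot.
From mathcomp Require Import boolp classical_sets functions cardinality.
From mathcomp Require Import wochoice.

(* The subgroup attached to a regular L <= K is the closure of an initial
   segment of G, of cardinality L for a well-order of G of minimal type, under
   chosen solutions of systems of fewer than L conditions whose coefficients
   and variables already lie in the closure. Enlarging L enlarges both the
   initial segment and the family of systems, so the chain is increasing
   without any recursion on L.
   - Under GCH a set of size L has only L subsets of size less than L when L is
     regular, so L steps of closing off give a set of size L.
   - A system over the closure C that is solvable in an overgroup H of C is
     solvable in an overgroup of G, namely an amalgam of G and H over C, hence
     in G, hence (after renaming its at most L variables by elements of C) by
     the chosen solution, which lies in C.
   - The chain exhausts G because the power set of an infinite set A is
     regular under GCH, and has size at most K when A has size less than K. *)

Set Implicit Arguments.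
Unset Strict Implicit.
Unset Printing Implicit Defensive.

Local Open Scope classical_set_scope.
Local Open Scope card_scope.

(** * Well-orders and cardinal arithmetic *)

Lemma inj_card_le_on T U (A : set T) (B : set U) (f : T -> U) :
  (forall x, A x -> B (f x)) -> {in A &, injective f} -> A #<= B.
Proof.
by move=> fAB fI; have /injfunPex[g] : exists2 f, set_fun A B f & set_inj A f;
  [exists f | exact: inj_card_le g].
Qed.

Lemma card_le_inj_in T U (A : set T) (u0 : U) :
  A #<= [set: U] -> exists f : T -> U, {in A &, injective f}.
Proof.
move: u0; elim/Ppointed: U => U u0; first by case: (no u0).
by move=> /pcard_injP.
Qed.

Lemma card_lt_le_trans T U V (A : set T) (B : set U) (C : set V) :
  A #< B -> B #<= C -> A #< C.
Proof.
move=> /andP[AB BA] BC; rewrite /card_lt (card_le_trans AB BC)/=.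
by apply: contra BA; exact: card_le_trans.
Qed.

Lemma card_le_lt_trans T U V (A : set T) (B : set U) (C : set V) :
  A #<= B -> B #< C -> A #< C.
Proof.
move=> AB /andP[BC CB]; rewrite /card_lt (card_le_trans AB BC)/=.
by apply: contra CB => /card_le_trans; apply.
Qed.

Definition seg T (R : T -> T -> Prop) (x : T) : set T := [set y | R y x].

Definition strict_wo T (R : T -> T -> Prop) : Prop :=
  [/\ well_founded R, (forall x y z, R x y -> R y z -> R x z) &
      forall x y, [\/ R x y, x = y | R y x]].

Lemma strict_wo_exists T : exists R : T -> T -> Prop, strict_wo R.
Proof.
have [R /= Rwo] := well_ordering_principle {classic T}.
have ch : wo_chain R predT by move=> A _; exact: Rwo.
have Rxx x : R x x by exact: (wo_chain_reflexive ch).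
have Ras x y : R x y -> R y x -> x = y.
  by move=> xy yx; apply: (wo_chain_antisymmetric ch) => //; rewrite xy yx.
have minE (A : set T) x : A x -> exists2 z, A z & forall y, A y -> R z y.
  move=> Ax; have [|z [[/asboolP Az zmin] _]] := Rwo (fun y => `[< A y >]).
    by exists x; apply/asboolP.
  by exists z => // y Ay; apply: zmin; apply/asboolP.
have Rtot x y : R x y \/ R y x.
  have [//|z [->|->] zmin] := minE [set x; y] x; first by left.
  - by left; apply: zmin; right.
  - by right; apply: zmin; left.
exists (fun x y => R x y /\ x <> y); split.
- move=> x; apply: contrapT => nx.
  have [//|z nz zmin] := minE [set x | ~ Acc (fun x y => R x y /\ x <> y) x] x.
  apply: nz; constructor => y [yz ne]; apply: contrapT => /zmin zy.
  by apply: ne; exact: Ras.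
(* Transitivity is read off the least of the three points: it must be [x], as the other cases
   contradict antisymmetry. *)
- move=> x y z [xy nxy] [yz nyz].
  have [//|t] := minE [set x; y; z] x; first by left; left.
  move=> [[->|->]|->] tmin.
  + split; first by apply: tmin; right.
    by move=> xz; apply: nxy; apply: Ras => //; rewrite xz.
  + by case: nxy; apply: Ras => //; apply: tmin; left; left.
  + by case: nyz; apply: Ras => //; apply: tmin; left; right.
- move=> x y; have [->|ne] := pselect (x = y); first by constructor 2.
  by have [xy|yx] := Rtot x y; [constructor 1|constructor 3; split=> // /esym].
Qed.

(* Map each point to a value not taken below it: this fails only when the
   values taken below some point already exhaust [B]. *)
Lemma wo_card_cases T (R : T -> T -> Prop) (U : Type) :
  strict_wo R -> [set: T] #<= [set: U] \/ exists x, [set: U] #<= seg R x.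
Proof.
move=> Rwo; case: (Rwo) => Rwf _ Rtri.
have [|nex] := pselect (exists x, [set: U] #<= seg R x); [by right|left].
have fresh x (g : forall y, R y x -> U) : exists u, forall y yx, g y yx <> u.
  apply: contrapT => nu; apply: nex; exists x.
  have hit (u : U) : exists y, exists yx : R y x, g y yx = u.
    apply: contrapT => nhit; apply: nu; exists u => y yx gu.
    by apply: nhit; exists y, yx.
  have [h hP] := choice hit.
  apply: (inj_card_le_on (f := h)) => [u _|u v _ _ huv].
    by have [] := hP u.
  have [yx <-] := hP u; have [yx' <-] := hP v.
  by move: yx yx'; rewrite huv => yx yx'; congr g; exact: Prop_irrelevance.
pose f := Fix Rwf (fun=> U) (fun x g => sval (cid (fresh x g))).
have fE x : f x = sval (cid (fresh x (fun y _ => f y))).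
  rewrite /f Fix_eq // => {}x g h gh.
  by have -> : g = h by do 2 apply: functional_extensionality_dep => ?.
have fne x y : R y x -> f y <> f x.
  by move=> yx; rewrite [f x]fE; case: cid => u /= /(_ y yx).
apply: (inj_card_le_on (f := f)) => // x y _ _ fxy.
by case: (Rtri x y) => [/fne/(_ fxy)|//|/fne/(_ (esym fxy))].
Qed.

(** A well-order of [A] either embeds in [B] or has a segment into which [B] injects. *)
Lemma card_le_total T U (A : set T) (B : set U) : A #<= B \/ B #<= A.
Proof.
have [R Rwo] := strict_wo_exists A.
have Ale : A #<= [set: A] by case/card_eqPle: (card_setT A).
have leA : [set: A] #<= A by case/card_eqPle: (card_setT A).
have Ble : B #<= [set: B] by case/card_eqPle: (card_setT B).
have leB : [set: B] #<= B by case/card_eqPle: (card_setT B).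
have [le|[x le]] := @wo_card_cases _ _ B Rwo.
  by left; apply: card_le_trans Ale (card_le_trans le leB).
right; apply: card_le_trans Ble (card_le_trans le _).
exact: card_le_trans (card_leT _) leA.
Qed.

Lemma card_ltNge T U (A : set T) (B : set U) : A #< B <-> ~ (B #<= A).
Proof.
split=> [/andP[_ /negP]//|nBA]; apply/andP; split; last exact/negP.
by case: (card_le_total A B).
Qed.

Lemma card_leNgt T U (A : set T) (B : set U) : A #<= B <-> ~ (B #< A).
Proof.
split=> [AB /card_ltNge//|nBA]; apply: contrapT => nAB.
by apply: nBA; apply/card_ltNge.
Qed.

Lemma strict_wo_inj T U (R : U -> U -> Prop) (g : T -> U) :
  injective g -> strict_wo R -> strict_wo (fun s t => R (g s) (g t)).
Proof.
move=> gI [Rwf Rtr Rtri]; split; first exact: wf_inverse_image Rwf.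
- by move=> r s t; exact: Rtr.
- move=> s t; case: (Rtri (g s) (g t)) => [|/gI|];
    by [constructor 1|constructor 2|constructor 3].
Qed.

Lemma card_le_injT T U (A : set T) :
  [set: U] #<= A -> exists2 f : U -> T, injective f & forall u, A (f u).
Proof.
move=> /card_leP[f]; exists (fun u => val (f (to_setT u))).
  move=> s t /val_inj fst; have /(congr1 val)//: to_setT s = to_setT t.
  by apply: (@inj _ _ _ f); rewrite ?in_setT.
by move=> u; exact: (set_valP (f (to_setT u))).
Qed.

(** Well-orders whose type is an initial ordinal. *)
Definition initial_wo T (R : T -> T -> Prop) : Prop :=
  strict_wo R /\ forall x, seg R x #< [set: T].

Lemma initial_wo_exists T : exists R : T -> T -> Prop, initial_wo R.
Proof.
have [R Rwo] := strict_wo_exists T; case: (Rwo) => Rwf Rtr Rtri.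
have [all|] := pselect (forall x, seg R x #< [set: T]); first by exists R.
move=> /existsNP[x0]; elim/(well_founded_ind Rwf): x0 => x IH nx.
have [[z zx /(IH z zx)//]|nmin] :=
  pselect (exists2 y, R y x & ~ (seg R y #< [set: T])).
(* Here [x] is the least point whose segment is as large as [T]. In the order pulled back along an
   injection of [T] into [seg R x], segments embed in segments of points below [x], which are small
   by minimality. *)
have /card_leNgt/card_le_injT[g gI gx] := nx.
exists (fun s t => R (g s) (g t)); split=> [|t]; first exact: strict_wo_inj.
have /card_le_lt_trans : seg (fun s t => R (g s) (g t)) t #<= seg R (g t).
  by apply: (inj_card_le_on (f := g)) => // a b _ _ /gI.
by apply; apply: contrapT => ny; apply: nmin; exists (g t) => //; exact: gx.
Qed.

Lemma infinite_setU1 T (A : set T) (x : T) : infinite_set A -> x |` A #<= A.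
Proof.
move=> /infiniteP/card_le_injT[f fI fA].
have [Ax|nAx] := pselect (A x).
  by apply: subset_card_le => y [->|].
(* Hilbert's hotel along the sequence [f]: the new point [x] takes the place of [f 0] and each [f n]
   moves to [f n.+1]. *)
pose g y := match pselect (y = x), pselect (exists n, f n = y) with
  | left _, _ => f 0
  | _, left e => f (sval (cid e)).+1
  | _, _ => y end.
apply: (inj_card_le_on (f := g)) => [y Ay|y z].
  rewrite /g; case: pselect => // yx; case: pselect => // _.
  by case: Ay.
rewrite !inE => Ay Az; rewrite /g; case: pselect => [->|yx].
  case: pselect => [->//|zx]; case: pselect => [e|ne].
    by move=> /fI.
  by move=> e; case: ne; exists 0.
case: pselect => [e|ne]; last first.
  case: pselect => [zx|zx]; first by move=> e; case: ne; exists 0.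
  case: pselect => [e ye|//]; by case: ne; rewrite ye; eexists.
case: pselect => [zx /fI//|zx]; case: pselect => [e'|ne' ez].
  move=> /fI; case: cid => m /= <-; case: cid => n /= <- [->] //.
by case: ne'; rewrite -ez; eexists.
Qed.

Lemma finite_infinite_card_lt T U (A : set T) (B : set U) :
  finite_set A -> infinite_set B -> A #< B.
Proof. by move=> fA iB; apply/card_ltNge => /card_le_finite/(_ fA). Qed.

(** Types smaller than [T] inject into segments of a well-order of [T], so well-founded induction on
    the points of [T] gives induction on cardinality. *)
Lemma card_lt_ind (P : Type -> Prop) :
  (forall T, (forall U : Type, [set: U] #< [set: T] -> P U) -> P T) ->
  forall T, P T.
Proof.
move=> IH T; have [R Rwo] := strict_wo_exists T.
have PS x (U : Type) : [set: U] #<= seg R x -> P U.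
  case: (Rwo) => Rwf _ _; elim/(well_founded_ind Rwf): x U => x IHx U Ux.
  apply: IH => V VU; have Rwo' := strict_wo_inj (@val_inj _ _ (seg R x)) Rwo.
  have [|[y Vy]] := @wo_card_cases _ _ V Rwo'.
    move/(card_le_trans (proj2 ((card_eqPle _ _).1 (card_setT (seg R x))))).
    by move/(card_lt_le_trans (card_lt_le_trans VU Ux))/card_ltNge; case.
  apply: (IHx (val y)); first exact: (set_valP y).
  apply: card_le_trans Vy _; apply: (inj_card_le_on (f := val)) => //.
  by move=> a b _ _ /val_inj.
apply: IH => U /card_ltNge nTU.
by have [//|[x /PS]] := @wo_card_cases _ _ U Rwo.
Qed.

(** * Products and unions of infinite cardinals *)

Definition lex T U (R : T -> T -> Prop) (S : U -> U -> Prop) (p q : T * U) :=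
  R p.1 q.1 \/ p.1 = q.1 /\ S p.2 q.2.

Lemma strict_wo_lex T U (R : T -> T -> Prop) (S : U -> U -> Prop) :
  strict_wo R -> strict_wo S -> strict_wo (lex R S).
Proof.
move=> [Rwf Rtr Rtri] [Swf Str Stri]; split.
- move=> [x y]; elim/(well_founded_ind Rwf): x y => x IHx.
  elim/(well_founded_ind Swf) => y IHy; constructor => -[x' y'].
  by move=> [/= /IHx//|[/= -> /IHy]].
- move=> [a a'] [b b'] [c c'] [/= ab|[/= -> ab]] [/= bc|[/= <- bc]].
  + by left => /=; exact: Rtr bc.
  + by left.
  + by left.
  + by right; split=> //=; exact: Str bc.
- move=> [a a'] [b b']; case: (Rtri a b) => [ab|<-|ba].
  + by constructor 1; left.
  + case: (Stri a' b') => [ab|<-|ba]; first by constructor 1; right.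
      by constructor 2.
    by constructor 3; right.
  + by constructor 3; left.
Qed.

Lemma card_leX T U L M (A : set T) (B : set U) (l0 : L) (m0 : M) :
  A #<= [set: L] -> B #<= [set: M] -> A `*` B #<= [set: L * M].
Proof.
move=> /(card_le_inj_in l0)[f fI] /(card_le_inj_in m0)[g gI].
apply: (inj_card_le_on (f := fun p => (f p.1, g p.2))) => // -[a b] [c d].
move=> /set_mem[/= Aa Bb] /set_mem[/= Ac Bd] [fac gbd].
by congr pair; [apply: fI|apply: gI] => //; exact: mem_set.
Qed.

Definition cseg T (R : T -> T -> Prop) (x : T) : set T := x |` seg R x.

Lemma initial_wo_cseg T (R : T -> T -> Prop) x : infinite_set [set: T] ->
  initial_wo R -> cseg R x #< [set: T].
Proof.
move=> iT [_ Rini].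
have [fin|inf] := pselect (finite_set (seg R x)).
  by apply: finite_infinite_card_lt => //; rewrite finite_setU; split.
exact: card_le_lt_trans (infinite_setU1 x inf) (Rini x).
Qed.

(** Order pairs by their maximum [m], then lexicographically. The pairs below [p] have both
    coordinates in the closed segment [C] up to [m p], and [C] times [C] is smaller than [T] by
    induction on cardinality; so no segment of pairs is as large as [T]. *)
Lemma infinite_square_card_le T :
  infinite_set [set: T] -> [set: T * T] #<= [set: T].
Proof.
elim/card_lt_ind: T => T IH iT.
have [R Rini] := initial_wo_exists T; case: (Rini) => Rwo _.
case: (Rwo) => _ Rtr Rtri.
pose m (p : T * T) := if pselect (R p.1 p.2) then p.2 else p.1.
have m1 p : p.1 = m p \/ R p.1 (m p) by rewrite /m; case: pselect; [right|left].
have m2 p : p.2 = m p \/ R p.2 (m p).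
  rewrite /m; case: pselect => /= [|nR]; [by left|].
  by case: (Rtri p.1 p.2) => // [->|]; [left|right].
pose g p := (m p, p).
have gI : injective g by move=> p q [].
have Qwo := strict_wo_inj gI (strict_wo_lex Rwo (strict_wo_lex Rwo Rwo)).
have [//|[p]] := @wo_card_cases _ _ T Qwo.
set C := cseg R (m p).
have CT : C #< [set: T] by exact: initial_wo_cseg.
have Ctr x y : x = y \/ R x y -> y = m p \/ R y (m p) -> C x.
  move=> xy H; move: xy.
  by case=> [->//|xy]; right; case: H => [<-//|]; exact: Rtr xy.
suff : C `*` C #< [set: T].
  move=> + le; suff /card_le_lt_trans/[apply] : [set: T] #<= C `*` C.
    by move=> /card_ltNge.
  apply: card_le_trans le _; apply: subset_card_le => q qp.
  have mqp : m q = m p \/ R (m q) (m p).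
    by case: qp => /= [|[]]; [right|left].
  by split; [apply: Ctr (m1 q) mqp|apply: Ctr (m2 q) mqp].
have [fin|inf] := pselect (finite_set C).
  by apply: finite_infinite_card_lt => //; exact: finite_setX.
have /card_eqPle[TC CTt] := card_setT C.
have [c0 _] := infinite_setN0 inf.
have Cp : C (m p) by left.
pose c : C := SigSub (mem_set Cp).
have CC : C `*` C #<= [set: C * C] by exact: card_leX.
have iC : infinite_set [set: C] by move/(card_le_finite CTt).
apply: card_le_lt_trans CC (card_le_lt_trans (IH C _ iC) _).
  exact: card_le_lt_trans TC CT.
exact: card_le_lt_trans TC CT.
Qed.

Lemma setX_card_le L T U (A : set T) (B : set U) : infinite_set [set: L] ->
  A #<= [set: L] -> B #<= [set: L] -> A `*` B #<= [set: L].
Proof.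
move=> iL AL BL; have [l0 _] := infinite_setN0 iL.
exact: card_le_trans (card_leX l0 l0 AL BL) (infinite_square_card_le iL).
Qed.

(** A point is coded by a chosen index of a piece containing it, together with its code inside that
    piece. *)
Lemma bigcup_card_le L I T (D : set I) (F : I -> set T) :
  infinite_set [set: L] -> D #<= [set: L] ->
  (forall i, D i -> F i #<= [set: L]) -> \bigcup_(i in D) F i #<= [set: L].
Proof.
move=> iL DL FL; have [l0 _] := infinite_setN0 iL.
have /choice[h hP] i : exists f : T -> L, D i -> {in F i &, injective f}.
  have [Di|nDi] := pselect (D i); last by exists (fun=> l0) => /nDi.
  by have [f fI] := card_le_inj_in l0 (FL i Di); exists f.
have [f fI] := card_le_inj_in l0 DL.
have [->//|/set0P[x0 [i0 Di0 Fx0]]] := eqVneq (\bigcup_(i in D) F i) set0.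
have /choice[k kP] x : exists i, (\bigcup_(i in D) F i) x -> D i /\ F i x.
  have [[i Di Fx]|nx] := pselect ((\bigcup_(i in D) F i) x); first by exists i.
  by exists i0 => /nx.
apply: card_le_trans (infinite_square_card_le iL).
apply: (inj_card_le_on (f := fun x => (f (k x), h (k x) x))) => // x y.
rewrite !inE => /kP[Dx Fx] /kP[Dy Fy] [] /fI; rewrite !inE => /(_ Dx Dy) kxy.
by rewrite kxy in Fx *; apply: (hP _ Dy); rewrite inE.
Qed.

(** * Regular cardinals and power sets under GCH *)

Lemma regular_bounded L (R : L -> L -> Prop) I (D : set I) (f : I -> L) :
  regular_cardinal L -> initial_wo R -> D #< [set: L] ->
  exists l, forall i, D i -> R (f i) l.
Proof.
move=> [iL reg] Rini DL; have [[_ _ Rtri] _] := Rini.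
have DL' : [set: D] #< [set: L].
  by apply: card_le_lt_trans DL; case/card_eqPle: (card_setT D).
have := reg D (fun i => cseg R (f (val i))) DL'.
(* If the points [f i] were unbounded, their closed segments, fewer than [L] sets each smaller than
   [L], would cover [L]. *)
move=> /(_ (fun i => initial_wo_cseg _ iL Rini)) ne.
apply: contrapT => nl; apply: ne; apply/seteqP; split=> // l _.
have /existsNP[i /not_implyP[Di nR]] : ~ forall i, D i -> R (f i) l.
  by move=> lP; apply: nl; exists l.
exists (SigSub (mem_set Di)) => //=.
by case: (Rtri (f i) l) => // [<-|]; [left|right].
Qed.

Lemma card_lt_powerset T : [set: T] #< [set: set T].
Proof.
apply/card_ltNge => /card_le_injT[g gI _].
(* Cantor's diagonal set for the injection [g] of the power set into [T]. *)
pose D := [set t | exists2 X, g X = t & ~ X t].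
have [Dg|nDg] := pselect (D (g D)); last by apply: (nDg); exists D.
by have [X /gI -> ] := Dg.
Qed.

Lemma powerset_card_le T (A : set T) :
  [set X | X `<=` A] #<= [set: set (set_type A)].
Proof.
apply: (inj_card_le_on (f := fun X : set T => val @^-1` X)) => // X Y.
rewrite !inE => XA YA /seteqP[XY YX]; apply/seteqP; split=> x Xx.
  by have := XY (SigSub (mem_set (XA _ Xx))); apply.
by have := YX (SigSub (mem_set (YA _ Xx))); apply.
Qed.

(** For infinite [A], a power set larger than [L] would put [L] strictly between [A] and its power;
    for finite [A], there are only countably many subsets. *)
Lemma GCH_powerset_card_le L T (A : set T) : GCH -> infinite_set [set: L] ->
  A #< [set: L] -> [set X | X `<=` A] #<= [set: L].
Proof.
move=> gch iL AL; have [fin|inf] := pselect (finite_set A).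
  have /subset_card_le/card_le_trans : [set X | X `<=` A] `<=`
      [set X | X `<=` A /\ finite_set X].
    by move=> X XA; split=> //; exact: sub_finite_set fin.
  apply; apply: card_le_trans (countable_finite_subset _) _.
    exact: finite_set_countable.
  exact/infiniteP.
apply: card_le_trans (powerset_card_le A) _; apply/card_leNgt => LA.
have /card_eqPle[TA AT] := card_setT A.
apply: (gch A L); first by move/(card_le_finite AT).
by split=> //; exact: card_le_lt_trans TA AL.
Qed.

(* By regularity a small subset of [L] lies in an initial segment, which has at
   most [L] subsets under GCH. *)
Lemma GCH_small_subsets L T (C : set T) : GCH -> regular_cardinal L ->
  C #<= [set: L] -> [set A | A `<=` C /\ A #< [set: L]] #<= [set: L].
Proof.
move=> gch Lreg CL; have [iL _] := Lreg; have [l0 _] := infinite_setN0 iL.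
have [R Rini] := initial_wo_exists L.
have [f fI] := card_le_inj_in l0 CL.
have imI : {in [set A | A `<=` C] &, injective (fun A => f @` A)}.
  move=> A B; rewrite !inE => AC BC /seteqP[AB BA].
  apply/seteqP; split=> x.
    move=> Ax; have [|y By] := AB (f x); first by exists x.
    move=> /fI <- //; rewrite inE; [exact: BC|exact: AC].
  move=> Bx; have [|y Ay] := BA (f x); first by exists x.
  move=> /fI <- //; rewrite inE; [exact: AC|exact: BC].
have : \bigcup_(l in [set: L]) [set X | X `<=` seg R l] #<= [set: L].
  apply: bigcup_card_le => // l _.
  by apply: GCH_powerset_card_le => //; case: Rini.
apply: card_le_trans.
apply: (inj_card_le_on (f := fun A => f @` A)) => [A [AC AL]|A B].
  have [l lP] := regular_bounded f Lreg Rini AL.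
  by exists l => // _ [x Ax <-]; exact: lP.
by rewrite !inE => -[AC _] [BC _]; apply: imI; rewrite inE.
Qed.

Lemma nat_regular : regular_cardinal nat.
Proof.
split; first exact: infinite_nat.
have ltfin T (A : set T) : A #< [set: nat] -> finite_set A.
  by move=> /card_ltNge nA; apply: contrapT => /infiniteP.
move=> J F /ltfin fJ Fs E; apply: infinite_nat; rewrite -E.
by apply: bigcup_finite => // j _; exact: ltfin.
Qed.

(** Under GCH anything smaller than the power set has size at most [T], and a union of at most [T]
    sets of size at most [T] is again of size at most [T]. *)
Lemma GCH_powerset_regular T : GCH -> infinite_set [set: T] ->
  regular_cardinal (set T).
Proof.
move=> gch iT; have /andP[Tle _] := card_lt_powerset T.
have iP : infinite_set [set: set T] by move/(card_le_finite Tle).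
have le U (A : set U) : A #< [set: set T] -> A #<= [set: T].
  move=> AP; apply/card_leNgt => TA; have /card_eqPle[TAA ATA] := card_setT A.
  apply: (gch T A) => //; split; first exact: card_lt_le_trans TA ATA.
  exact: card_le_lt_trans TAA AP.
split=> // J F /le Jle Fs E; have /card_ltNge := card_lt_powerset T; apply.
by rewrite -E; apply: bigcup_card_le => // j _; exact: le.
Qed.

(** * Amalgamation *)

(** Permutations carry their inverse as data, so that group inversion merely swaps the two maps. *)
Record sym (X : Type) : Type := Sym {
  symf :> X -> X;
  symfV : X -> X;
  symK : cancel symf symfV;
  symKV : cancel symfV symf }.

Lemma sym_ext X (p q : sym X) : p =1 q -> p = q.
Proof.
case: p q => [f f' fK f'K] [g g' gK g'K] /= /funext fg.
rewrite fg in fK f'K *.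
have fg' : f' = g' by apply/funext => x; rewrite -{1}(g'K x) fK.
rewrite fg' in fK f'K *.
by congr Sym; exact: Prop_irrelevance.
Qed.

Section SymGroup.
Variable X : Type.
Implicit Types p q r : sym X.

HB.instance Definition _ := gen_eqMixin (sym X).
HB.instance Definition _ := gen_choiceMixin (sym X).

Definition sym1 : sym X := @Sym X id id (fun=> erefl) (fun=> erefl).

Definition symV p : sym X := Sym (symKV p) (symK p).

Definition symM p q : sym X :=
  Sym (can_comp (symK p) (symK q)) (can_comp (symKV q) (symKV p)).

Fact symMA : associative symM. Proof. by move=> p q r; exact: sym_ext. Qed.

Fact sym1M : left_id sym1 symM. Proof. by move=> p; exact: sym_ext. Qed.

Fact symM1 : right_id sym1 symM. Proof. by move=> p; exact: sym_ext. Qed.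

Fact symVM : left_inverse sym1 symV symM.
Proof. by move=> p; apply: sym_ext; exact: symK. Qed.

Fact symMV : right_inverse sym1 symV symM.
Proof. by move=> p; apply: sym_ext; exact: symKV. Qed.

HB.instance Definition _ := isGroup.Build (sym X) symMA sym1M symM1 symVM symMV.

End SymGroup.

Section ActionSym.
Variables (G : groupType) (X : Type) (act : G -> X -> X).
Hypothesis act1 : forall x, act 1%g x = x.
Hypothesis actM : forall g h x, act (g * h)%g x = act g (act h x).

Fact actK g : cancel (act g) (act g^-1%g).
Proof. by move=> x; rewrite -actM mulVg act1. Qed.

Fact actKV g : cancel (act g^-1%g) (act g).
Proof. by move=> x; rewrite -actM mulgV act1. Qed.

Definition act_sym (g : G) : sym X := Sym (@actK g) (@actKV g).

Fact act_symM : {morph act_sym : g h / (g * h)%g}.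
Proof. by move=> g h; apply: sym_ext => x; exact: actM. Qed.

HB.instance Definition _ := isMultiplicative.Build G (sym X) act_sym act_symM.

Lemma action_hom : exists f : {multiplicative G -> sym X},
  forall g x, f g x = act g x.
Proof. by exists act_sym. Qed.

End ActionSym.

Lemma multiplicative_1 (G H : groupType) (f : {multiplicative G -> H}) :
  f 1%g = 1%g.
Proof. by apply: (mulgI (f 1%g)); rewrite -gmulfM !mulg1. Qed.

(** Choosing a representative in each right coset of the image of [A] splits [G] as [A * S], with
    [A] acting by left multiplication on the first factor only. *)
Lemma coset_decomposition (A G : groupType) (a : {multiplicative A -> G}) :
  injective a ->
  exists (S : Type) (_ : S) (phi : A * S -> G) (psi : G -> A * S),
    [/\ cancel phi psi, cancel psi phi &
        forall y p, phi ((y * p.1)%g, p.2) = (a y * phi p)%g].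
Proof.
move=> aI; pose coset x := [set y | exists c, y = (a c * x)%g].
have cosetM c x : coset (a c * x)%g = coset x.
  apply/seteqP; split=> y [d ->].
    by exists (d * c)%g; rewrite gmulfM mulgA.
  by exists (d * c^-1)%g; rewrite mulgA -gmulfM mulgVK.
pose rep x := xget 1%g (coset x).
have repP x : coset x (rep x).
  by apply: (xgetPex 1%g); exists x; exists 1%g; rewrite multiplicative_1 mul1g.
have repM c x : rep (a c * x)%g = rep x by rewrite /rep cosetM.
have repK x : rep (rep x) = rep x.
  by have [c {1}->] := repP x; rewrite repM.
have /choice[al alP] x : exists c, x = (a c * rep x)%g.
  have [c ->] := repP x; exists c^-1%g.
  by rewrite mulgA -gmulfM mulVg multiplicative_1 mul1g.
(* The transversal is the set of fixed points of [rep]; the representative of the trivial coset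
   serves as the base point. *)
exists {s : G | rep s == s}.
exists (exist _ (rep 1%g) (introT eqP (repK 1%g))).
exists (fun p => a p.1 * val p.2)%g.
exists (fun x => (al x, exist _ (rep x) (introT eqP (repK x)))).
split=> /= [[y [s sP]]|x|y p]; last by rewrite gmulfM mulgA.
  have e : rep (a y * s)%g = s by rewrite repM (eqP sP).
  congr pair; last exact: val_inj.
  apply: aI; apply: (mulIg s); rewrite /=.
  by have := alP (a y * s)%g; rewrite e.
by rewrite /= -alP.
Qed.

(* Neumann's permutational product: with [G = A * S] and [H = A * T] as right
   coset decompositions, both groups act faithfully on [A * S * T] by left
   multiplication, and these actions agree on [A]. *)
Lemma amalgamation (A G H : groupType)
    (a : {multiplicative A -> G}) (b : {multiplicative A -> H}) :
  injective a -> injective b ->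
  exists (P : groupType) (i : {multiplicative G -> P})
    (j : {multiplicative H -> P}),
    [/\ injective i, injective j & forall x, i (a x) = j (b x)].
Proof.
move=> aI bI.
have [S [s0 [phi [phi' [phiK phi'K phiM]]]]] := coset_decomposition aI.
have [T [t0 [psi [psi' [psiK psi'K psiM]]]]] := coset_decomposition bI.
pose X : Type := (A * S * T)%type.
pose actG g (x : X) : X := (phi' (g * phi x.1)%g, x.2).
pose actH h (x : X) : X :=
  let y := psi' (h * psi (x.1.1, x.2))%g in (y.1, x.1.2, y.2).
have [|g h x|i iE] := @action_hom G X actG.
- by move=> [p t]; rewrite /actG mul1g phiK.
- by rewrite /actG /= phi'K mulgA.
have [|g h x|j jE] := @action_hom H X actH.
- by move=> [[y s] t]; rewrite /actH mul1g psiK.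
- by rewrite /actH /= -surjective_pairing psi'K mulgA.
exists (sym X), i, j; split.
- move=> g h /(congr1 (fun p : sym X => p (1%g, s0, t0))); rewrite !iE.
  by move=> [/(can_inj phi'K)/mulIg].
- move=> g h /(congr1 (fun p : sym X => p (1%g, s0, t0))); rewrite !jE.
  rewrite /actH /= => -[e1 e2]; apply: (mulIg (psi (1%g, t0))).
  apply: (can_inj psi'K).
  by rewrite [LHS]surjective_pairing [RHS]surjective_pairing e1 e2.
(* By equivariance of [phi] and [psi], both images of [x] multiply the [A] coordinate by [x] and fix
   the other two. *)
- move=> x; apply: sym_ext => -[[y s] t]; rewrite iE jE /actG /actH /=.
  by rewrite -phiM -psiM phiK psiK.
Qed.

(** * Group words and systems of conditions *)

Lemma multiplicative_V (G H : groupType) (f : {multiplicative G -> H}) x :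
  f x^-1%g = (f x)^-1%g.
Proof.
by apply: (mulgI (f x)); rewrite -gmulfM !mulgV multiplicative_1.
Qed.

Fixpoint gword_map A B X Y (c : A -> B) (r : X -> Y) (w : gword A X) :
    gword B Y :=
  match w with
  | GConst g => GConst _ (c g)
  | GVar x => GVar (r x)
  | GMul w1 w2 => GMul (gword_map c r w1) (gword_map c r w2)
  | GInv w1 => GInv (gword_map c r w1)
  end.

Definition cond_map A B X Y (c : A -> B) (r : X -> Y) (q : condition A X) :
    condition B Y :=
  match q with
  | Equation w1 w2 => Equation (gword_map c r w1) (gword_map c r w2)
  | Inequation w1 w2 => Inequation (gword_map c r w1) (gword_map c r w2)
  end.

Fixpoint gword_consts A X (w : gword A X) : set A :=
  match w with
  | GConst g => [set g]
  | GVar _ => set0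
  | GMul w1 w2 => gword_consts w1 `|` gword_consts w2
  | GInv w1 => gword_consts w1
  end.

Fixpoint gword_vars A X (w : gword A X) : set X :=
  match w with
  | GConst _ => set0
  | GVar x => [set x]
  | GMul w1 w2 => gword_vars w1 `|` gword_vars w2
  | GInv w1 => gword_vars w1
  end.

Definition cond_consts A X (q : condition A X) : set A :=
  match q with
  | Equation w1 w2 | Inequation w1 w2 => gword_consts w1 `|` gword_consts w2
  end.

Definition cond_vars A X (q : condition A X) : set X :=
  match q with
  | Equation w1 w2 | Inequation w1 w2 => gword_vars w1 `|` gword_vars w2
  end.

Lemma gword_consts_map A B X Y (c : A -> B) (r : X -> Y) w :
  gword_consts (gword_map c r w) = c @` gword_consts w.
Proof.
elim: w => [g|x|w1 IH1 w2 IH2|w1 IH1] //=; first by rewrite image_set1.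
  by rewrite image_set0.
by rewrite IH1 IH2 image_setU.
Qed.

Lemma gword_vars_map A B X Y (c : A -> B) (r : X -> Y) w :
  gword_vars (gword_map c r w) = r @` gword_vars w.
Proof.
elim: w => [g|x|w1 IH1 w2 IH2|w1 IH1] //=; first by rewrite image_set0.
  by rewrite image_set1.
by rewrite IH1 IH2 image_setU.
Qed.

Lemma cond_consts_map A B X Y (c : A -> B) (r : X -> Y) q :
  cond_consts (cond_map c r q) = c @` cond_consts q.
Proof. by case: q => w1 w2 /=; rewrite !gword_consts_map image_setU. Qed.

Lemma cond_vars_map A B X Y (c : A -> B) (r : X -> Y) q :
  cond_vars (cond_map c r q) = r @` cond_vars q.
Proof. by case: q => w1 w2 /=; rewrite !gword_vars_map image_setU. Qed.

Lemma finite_gword_consts A X (w : gword A X) : finite_set (gword_consts w).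
Proof. by elim: w => //= w1 ? w2 ?; rewrite finite_setU. Qed.

Lemma finite_gword_vars A X (w : gword A X) : finite_set (gword_vars w).
Proof. by elim: w => //= w1 ? w2 ?; rewrite finite_setU. Qed.

Lemma finite_cond_consts A X (q : condition A X) : finite_set (cond_consts q).
Proof. by case: q => w1 w2 /=; rewrite finite_setU; split;
  exact: finite_gword_consts. Qed.

Lemma finite_cond_vars A X (q : condition A X) : finite_set (cond_vars q).
Proof. by case: q => w1 w2 /=; rewrite finite_setU; split;
  exact: finite_gword_vars. Qed.

Lemma satisfies_map A B (H : groupType) (f : B -> H) X Y (v : Y -> H)
    (c : A -> B) (r : X -> Y) q :
  satisfies f v (cond_map c r q) <-> satisfies (f \o c) (v \o r) q.
Proof.
have E w : gword_eval f v (gword_map c r w) = gword_eval (f \o c) (v \o r) w.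
  by elim: w => //= [w1 -> w2 ->|w1 ->].
by case: q => w1 w2 /=; rewrite !E.
Qed.

Lemma satisfies_hom A (H P : groupType) (i : {multiplicative H -> P})
    (f : A -> H) X (v : X -> H) q : injective i ->
  satisfies (i \o f) (i \o v) q <-> satisfies f v q.
Proof.
move=> iI.
have E w : gword_eval (i \o f) (i \o v) w = i (gword_eval f v w).
  by elim: w => //= [w1 -> w2 ->|w1 ->]; rewrite ?gmulfM ?multiplicative_V.
by case: q => w1 w2 /=; rewrite !E; [split=> [/iI|->]|
  split=> ne e; apply: ne; rewrite ?e //; apply: iI].
Qed.

Lemma satisfies_eq A (H : groupType) (f : A -> H) X (v v' : X -> H) q :
  (forall x, cond_vars q x -> v x = v' x) ->
  satisfies f v q -> satisfies f v' q.
Proof.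
have E w : (forall x, gword_vars w x -> v x = v' x) ->
    gword_eval f v w = gword_eval f v' w.
  elim: w => //= [x|w1 IH1 w2 IH2|w1 IH1] vv'; first exact: vv'.
    by rewrite IH1 ?IH2 // => x xw; apply: vv'; by [left|right].
  by rewrite IH1.
by case: q => w1 w2 /= vv'; rewrite !E // => x xw; apply: vv'; by [left|right].
Qed.

Lemma gword_card_le L A X (C : set A) (D : set X) : infinite_set [set: L] ->
  C #<= [set: L] -> D #<= [set: L] ->
  [set w | gword_consts w `<=` C /\ gword_vars w `<=` D] #<= [set: L].
Proof.
move=> iL CL DL; have [l0 _] := infinite_setN0 iL.
have [f fI] := card_le_inj_in l0 CL; have [g gI] := card_le_inj_in l0 DL.
have [p pI _] := card_le_injT (infinite_square_card_le iL).
have [n nI _] := card_le_injT ((infiniteP _).1 iL).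
(* Words become elements of [L] by iterating the pairing [p], with the distinct tags [n 0] to [n 3]
   recording the constructor; the code is injective on words over [C] and [D], where [f] and [g]
   are. *)
pose code := fix code (w : gword A X) := match w with
  | GConst c => p (n 0, f c)
  | GVar x => p (n 1, g x)
  | GMul w1 w2 => p (n 2, p (code w1, code w2))
  | GInv w1 => p (n 3, code w1) end.
apply: (inj_card_le_on (f := code)) => // w w' /set_mem + /set_mem.
elim: w w' => [c|x|w1 IH1 w2 IH2|w1 IH1] [c'|x'|w1' w2'|w1'] //=;
  move=> [sC sD] [sC' sD'] /pI[]; try by move=> /nI.
- by move=> /fI ->//; rewrite inE; [exact: sC|exact: sC'].
- by move=> /gI ->//; rewrite inE; [exact: sD|exact: sD'].
- move: sC sD sC' sD'; rewrite !subUset => -[? ?] [? ?] [? ?] [? ?] /pI[].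
  by move=> /IH1 -> // /IH2 ->.
- by move=> /IH1 ->.
Qed.

Lemma cond_card_le L A X (C : set A) (D : set X) : infinite_set [set: L] ->
  C #<= [set: L] -> D #<= [set: L] ->
  [set q | cond_consts q `<=` C /\ cond_vars q `<=` D] #<= [set: L].
Proof.
move=> iL CL DL; have WL := gword_card_le iL CL DL.
set W := [set w | _] in WL.
have BL : [set: bool] #<= [set: L].
  by have /andP[] := finite_infinite_card_lt (@finite_finset _ [set: bool]) iL.
have := setX_card_le iL BL (setX_card_le iL WL WL).
apply: card_le_trans.
pose t (q : condition A X) := match q with
  | Equation w1 w2 => (true, (w1, w2))
  | Inequation w1 w2 => (false, (w1, w2)) end.
apply: (inj_card_le_on (f := t)) => [[w1 w2|w1 w2] /=|].
- by rewrite !subUset => -[[? ?] [? ?]]; do !split.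
- by rewrite !subUset => -[[? ?] [? ?]]; do !split.
- by move=> [w1 w2|w1 w2] [w3 w4|w3 w4] _ _ //= [-> ->].
Qed.

(** * Closing off under chosen solutions *)

Section Hull.
Variable G : groupType.
Implicit Types (C B : set G) (S : set (condition G G)).

(* Elements of [G] double as variable names, so that a system has its
   variables, like its coefficients, in a given subset of [G]. *)
Definition sol S : G -> G :=
  match pselect (solvable_in (@id G) S) with
  | left e => sval (cid e)
  | right _ => id
  end.

Lemma solP S : solvable_in (@id G) S -> forall q, S q -> satisfies id (sol S) q.
Proof. by rewrite /sol; case: pselect => // e _; case: cid. Qed.

Definition conds_over C : set (condition G G) :=
  [set q | cond_consts q `<=` C /\ cond_vars q `<=` C].

(** An unsolvable system imposes nothing, since [sol] is then the identity. *)
Definition sol_closed (L : cardinal) C : Prop :=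
  forall S, S #< [set: L] -> S `<=` conds_over C ->
  forall v, C v -> C (sol S v).

Definition subgroup C : Prop :=
  [/\ C 1%g, forall x y, C x -> C y -> C (x * y)%g & forall x, C x -> C x^-1%g].

(** Taking an intersection makes monotonicity in both [L] and [B] immediate; the size is bounded
    separately, through the stages below. *)
Definition hull (L : cardinal) B : set G :=
  [set x | forall C, subgroup C -> sol_closed L C -> B `<=` C -> C x].

Lemma conds_overS C C' : C `<=` C' -> conds_over C `<=` conds_over C'.
Proof. by move=> CC' q [qc qv]; split; exact: subset_trans CC'. Qed.

Lemma sub_hull L B : B `<=` hull L B.
Proof. by move=> x Bx C _ _; apply. Qed.

Lemma hull_min L B C : subgroup C -> sol_closed L C -> B `<=` C ->
  hull L B `<=` C.
Proof. by move=> C1 C2 C3 x; apply. Qed.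

Lemma hull_subgroup L B : subgroup (hull L B).
Proof.
split=> [C [] //|x y Hx Hy C Cg Cs BC|x Hx C Cg Cs BC].
  by case: (Cg) => _ + _; apply;
    [exact: (Hx _ Cg Cs BC)|exact: (Hy _ Cg Cs BC)].
by case: (Cg) => _ _; apply; exact: (Hx _ Cg Cs BC).
Qed.

Lemma hull_sol_closed L B : sol_closed L (hull L B).
Proof.
move=> S SL Sover v Hv C Cg Cs BC; apply: (Cs) => //;
  last exact: (Hv _ Cg Cs BC).
by apply: subset_trans Sover (conds_overS _); exact: hull_min.
Qed.

Lemma hullS (L M : cardinal) B B' : [set: L] #<= [set: M] -> B `<=` B' ->
  hull L B `<=` hull M B'.
Proof.
move=> LM BB' x Hx C Cg Cs B'C; apply: (Hx _ Cg) => //;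
  last exact: subset_trans B'C.
by move=> S SL; apply: Cs; exact: card_lt_le_trans LM.
Qed.

(** The group operations are themselves solutions of one-equation systems, so the stages need not be
    closed off under them explicitly. *)
Lemma sol_closed_subgroup (L : cardinal) C : infinite_set [set: L] ->
  C !=set0 -> sol_closed L C -> subgroup C.
Proof.
move=> iL [c Cc] Cs.
(* A single equation [x = w] forces the chosen solution to map [x] to [w]. *)
have step x (w : gword G G) : C x -> gword_consts w `<=` C ->
    gword_vars w = set0 -> C (gword_eval id id w).
  move=> Cx wC wv; set S := [set Equation (GVar x) w].
  have ev (v : G -> G) : gword_eval id v w = gword_eval id id w.
    elim: w wv {wC S} => //= [y|w1 IH1 w2 IH2|w1 IH1].
    - by move/seteqP => [/(_ y erefl)].
    - by rewrite setU_eq0 => -[/IH1 -> /IH2 ->].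
    - by move/IH1 ->.
  have Ssol : solvable_in id S.
    by exists (fun=> gword_eval id id w) => _ -> /=; rewrite ev.
  have := solP Ssol (erefl : S _) => /=; rewrite ev => <-.
  apply: Cs => //.
    by apply: finite_infinite_card_lt => //; exact: finite_set1.
  move=> _ ->; split=> /=; first by rewrite set0U.
  by rewrite wv setU0 => _ ->.
split.
- have := step c (GMul (GConst _ c) (GInv (GConst _ c))) Cc.
  rewrite /= mulgV; apply; last by rewrite setU0.
  by rewrite setUid => _ ->.
- move=> x y Cx Cy; apply: (step c (GMul (GConst _ x) (GConst _ y))) => //=.
    by move=> z [->|->].
  by rewrite setU0.
- by move=> x Cx; apply: (step c (GInv (GConst _ x))) => //= _ ->.
Qed.

(** The hull built from below in steps indexed by [L]. All data of a system come from a single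
    earlier stage [m], which makes the new elements easy to count. *)
Inductive stage (L : cardinal) (R : L -> L -> Prop) B : L -> G -> Prop :=
  | stage_base l x of B x : stage R B l x
  | stage_sol m l S v of R m l & S #< [set: L] &
      (forall q x, S q -> cond_consts q x -> stage R B m x) &
      (forall q x, S q -> cond_vars q x -> stage R B m x) &
      stage R B m v : stage R B l (sol S v).

Section StageTheory.
Variables (L : cardinal) (R : L -> L -> Prop) (B : set G).
Hypotheses (gch : GCH) (Lreg : regular_cardinal L) (Rini : initial_wo R).
Hypotheses (BL : B #<= [set: L]).

Lemma stageS m l : R m l -> stage R B m `<=` stage R B l.
Proof.
move=> ml x sx; case: Rini => -[_ Rtr _] _; move: ml.
case: m x / sx => [m x Bx _|k m S v km SL Sc Sv kv ml].
  exact: stage_base.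
by apply: (stage_sol _ SL Sc Sv kv); exact: Rtr ml.
Qed.

Lemma stage_card_le l : stage R B l #<= [set: L].
Proof.
have [iL _] := Lreg; case: (Rini) => -[Rwf _ _] _.
elim/(well_founded_ind Rwf): l => l IH.
(* [F m] collects the values of chosen solutions of small systems over stage [m]. There are at most
   [L] conditions over that stage, hence at most [L] such systems by [GCH_small_subsets]. Stage [l]
   lies in the union of [B] and the [F m] for [m] below [l]. *)
pose F m := (fun p => sol p.1 p.2) @`
  ([set S | S `<=` conds_over (stage R B m) /\ S #< [set: L]] `*` stage R B m).
have FL m : R m l -> F m #<= [set: L].
  move=> /IH mL; apply: card_le_trans (card_image_le _ _) _.
  apply: setX_card_le => //; apply: GCH_small_subsets => //.
  exact: cond_card_le.
pose E (b : bool) := if b then B else \bigcup_(m in seg R l) F m.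
have : \bigcup_(b in [set: bool]) E b #<= [set: L].
  apply: bigcup_card_le => // [|[] _ //=].
    have fin_bool := @finite_finset _ [set: bool].
    by have /andP[] := finite_infinite_card_lt fin_bool iL.
  by apply: bigcup_card_le => //; exact: card_leT.
apply: card_le_trans; apply: subset_card_le => x sx.
suff [Bx|Fx] : B x \/ (\bigcup_(m in seg R l) F m) x
  by [exists true|exists false].
clear IH FL E; case: l x / sx => [l x Bx|k l S v kl SL Sc Sv kv].
  by left.
right.
exists k => //; exists (S, v) => //; split=> //=; split=> //.
by move=> q Sq; split=> x; [exact: Sc|exact: Sv].
Qed.

(** A condition mentions finitely many elements, so it lies over one stage; by regularity the stages
    needed for fewer than [L] conditions have a common bound. *)
Lemma stage_union_sol_closed :
  sol_closed L (\bigcup_(l in [set: L]) stage R B l).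
Proof.
have [iL _] := Lreg; case: (Rini) => -[_ Rtr Rtri] _.
have [l0 _] := infinite_setN0 iL.
have fin_bound T (D : set T) (f : T -> L) : finite_set D ->
    exists l, forall x, D x -> R (f x) l.
  move=> fD; apply: (regular_bounded f Lreg Rini).
  exact: finite_infinite_card_lt.
have fin_stage D : finite_set D -> D `<=` \bigcup_(l in [set: L]) stage R B l ->
    exists l, D `<=` stage R B l.
  move=> fD Ds; have /choice[f fP] x : exists l, D x -> stage R B l x.
    have [/Ds[l _ lx]|nDx] := pselect (D x); first by exists l.
    by exists l0 => /nDx.
  have [l lP] := fin_bound _ _ f fD; exists l => x Dx.
  by apply: stageS (lP _ Dx) _ _; exact: fP.
move=> S SL Sover v [lv _ vlv].
have /choice[f fP] q : exists l, S q ->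
    cond_consts q `|` cond_vars q `<=` stage R B l.
  have [Sq|nSq] := pselect (S q); last by exists l0 => /nSq.
  have [||l lP] := fin_stage (cond_consts q `|` cond_vars q); last by exists l.
  - rewrite finite_setU.
    by split; [exact: finite_cond_consts|exact: finite_cond_vars].
  - by rewrite subUset; exact: Sover.
have [l lP] := regular_bounded f Lreg Rini SL.
(* Stage [m] contains the data of the whole system and the variable [v]; the value of the solution
   appears at the later stage [n]. *)
have [//|m mP] := fin_bound _ [set l; lv] id.
have [n nP] := fin_bound _ [set m] id (finite_set1 m).
exists n => //; apply: (@stage_sol _ _ _ m) => //.
- exact: nP.
- move=> q x Sq qx; apply: stageS (mP l (or_introl erefl)) _ _.
  by apply: stageS (lP _ Sq) _ _; apply: fP => //; left.
- move=> q x Sq qx; apply: stageS (mP l (or_introl erefl)) _ _.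
  by apply: stageS (lP _ Sq) _ _; apply: fP => //; right.
- exact: stageS (mP lv (or_intror erefl)) _ vlv.
Qed.

End StageTheory.

Lemma hull_card_le (L : cardinal) B : GCH -> regular_cardinal L ->
  B #<= [set: L] -> B !=set0 -> hull L B #<= [set: L].
Proof.
move=> gch Lreg BL [b Bb]; have [iL _] := Lreg.
have [l0 _] := infinite_setN0 iL.
have [R Rini] := initial_wo_exists L.
apply: (@card_le_trans _ _ _ (\bigcup_(l in [set: L]) stage R B l)); last first.
  by apply: bigcup_card_le => // l _; exact: stage_card_le.
apply: subset_card_le; have cl := stage_union_sol_closed (B := B) Lreg Rini.
apply: hull_min => //; last by move=> x Bx; exists l0 => //; exact: stage_base.
by apply: sol_closed_subgroup cl => //; exists b, l0 => //; exact: stage_base.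
Qed.

End Hull.

(** * The chain of subgroups *)

Lemma groupClosed_of_subgroup (G : groupType) (C : set G) : subgroup C ->
  exists S : groupClosed G, [set` S] = C.
Proof.
move=> [C1 CM CV]; pose P : {pred G} := fun x => `[< C x >].
have PM : mulg_closed P.
  by move=> x y /asboolP Cx /asboolP Cy; apply/asboolP; exact: CM.
have P1 : (1%g : G) \in P by exact/asboolP.
have PV : invg_closed P by move=> x /asboolP Cx; apply/asboolP; exact: CV.
pose mM := isMulClosed.Build G P PM.
pose m1 := isMul1Closed.Build G P P1.
pose mV := isInvClosed.Build G P PV.
pose S : groupClosed G := HB.pack P mM m1 mV.
by exists S; apply/seteqP; split=> x; [move/asboolP|move=> Cx; apply/asboolP].
Qed.

Lemma card_le_injon T U (A : set T) (B : set U) (u0 : U) : A #<= B ->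
  exists2 f : T -> U, (forall x, A x -> B (f x)) & {in A &, injective f}.
Proof.
move: u0; elim/Ppointed: U B => U B u0; first by case: (no u0).
by move=> /pcard_leP/injfunPex[f fAB fI]; exists f.
Qed.

Lemma sol_closed_existentially_closed (K L : cardinal) (G : groupType)
    (C : groupClosed G) :
  existentially_closed K G -> infinite_set [set: L] -> [set: L] #<= [set: K] ->
  [set: L] #<= [set` C] -> sol_closed L [set` C] ->
  existentially_closed L (subgroup_type C).
Proof.
move=> G_ec iL LK LC Csol X S SL [H [f [fI [v vS]]]].
pose a : {multiplicative subgroup_type C -> G} := val.
have aI : injective a by exact: val_inj.
have [P [i [j [iI jI ij]]]] := amalgamation aI fI.
have imL (Y : Type) (r : X -> Y) : cond_map a r @` S #< [set: L].
  by apply: card_le_lt_trans SL; exact: card_image_le.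
(* The overgroup of [G] is the amalgam [P]: the solution in [H] remains one in [P] because [i] and
   [j] agree on [C]. *)
have [|v1 v1S] := G_ec X (cond_map a id @` S) (card_lt_le_trans (imL X id) LK).
  exists P, i; split=> //; exists (j \o v) => _ [q Sq <-].
  apply/satisfies_map; have -> : i \o a = j \o f by apply/funext.
  by apply/satisfies_hom => //; exact: vS.
(* Only variables occurring in [S] matter. There are at most [L] of them, so they can be renamed
   injectively by elements of [C], giving a system to which [sol] applies. *)
pose V := \bigcup_(q in S) cond_vars q.
have [|r rC rI] := @card_le_injon _ _ V [set` C] 1%g.
  apply: card_le_trans LC; apply: bigcup_card_le => // [|q _].
    by case/andP: SL.
  have /andP[] // := finite_infinite_card_lt (finite_cond_vars q) iL.
pose S2 := cond_map a r @` S.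
have S2sol : solvable_in id S2.
  (* Injectivity of [r] on [V] allows [v1] to be carried over to the renamed variables. *)
  have /choice[v2 v2P] y : exists z, forall x, V x -> r x = y -> z = v1 x.
    have [[x Vx <-]|nx] := pselect (exists2 x, V x & r x = y).
      by exists (v1 x) => x' Vx' /rI -> //; rewrite inE.
    by exists 1%g => x Vx rx; case: nx; exists x.
  exists v2 => _ [q Sq <-]; apply/satisfies_map.
  have /satisfies_map : satisfies id v1 (cond_map a id q).
    by apply: v1S; exists q.
  by apply: satisfies_eq => x qx /=; apply/esym/v2P => //; exists q.
have solS2 := solP S2sol.
have solC x : V x -> sol S2 (r x) \in C.
  move=> Vx; apply: (Csol S2 (imL _ r) _ (r x)); last exact: rC.
  move=> _ [q Sq <-]; split; rewrite ?cond_consts_map ?cond_vars_map.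
    by move=> _ [y _ <-]; exact: (valP y).
  by move=> _ [y qy <-]; apply: rC; exists q.
have /choice[u uP] x : exists y : subgroup_type C, V x -> a y = sol S2 (r x).
  have [Vx|nVx] := pselect (V x); last by exists 1%g => /nVx.
  by exists (Sub (sol S2 (r x)) (solC x Vx)) => _; exact: SubK.
exists u => q Sq; apply/(satisfies_hom id u q aI).
have /satisfies_map : satisfies id (sol S2) (cond_map a r q).
  by apply: solS2; exists q.
by apply: satisfies_eq => x qx /=; apply/esym/uP; exists q.
Qed.

(** * Initial segments of prescribed cardinality *)

Section SmallSegs.
Variables (T : Type) (R : T -> T -> Prop).
Hypothesis Rini : initial_wo R.

(** Cut off by size instead of by an endpoint, this segment depends only on the cardinality of [L],
    grows with [L], and is all of [T] once [L] is as large as [T]. *)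
Definition small_segs (L : cardinal) : set T := [set x | seg R x #< [set: L]].

Lemma small_segs_card_le L : small_segs L #<= [set: L].
Proof.
have [Rwo _] := Rini; have /card_eqPle[TA AT] := card_setT (small_segs L).
apply: card_le_trans AT _.
have Rwo' := strict_wo_inj (@val_inj _ _ (small_segs L)) Rwo.
(* Otherwise [L] would inject into the segment of a point of [small_segs L]. *)
have [//|[x Lx]] := @wo_card_cases _ _ L Rwo'.
have /card_ltNge[] := set_valP x; apply: card_le_trans Lx _.
by apply: (inj_card_le_on (f := val)) => // y z _ _ /val_inj.
Qed.

Lemma card_le_small_segs (L : cardinal) : [set: L] #<= [set: T] ->
  [set: L] #<= small_segs L.
Proof.
move=> LT; have [[Rwf _ _] _] := Rini.
have [<-//|ne] := pselect ([set: T] = small_segs L).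
have /existsNP[x0] : ~ forall x, small_segs L x.
  by move=> all; apply: ne; apply/seteqP; split=> x _.
elim/(well_founded_ind Rwf): x0 => x IH nx.
have [[y yx /(IH y yx)//]|nmin] :=
  pselect (exists2 y, R y x & ~ small_segs L y).
(* The segment of the least point [x] outside [small_segs L] has size at least [L] and, by
   minimality, lies inside [small_segs L]. *)
have /card_leNgt Lx := nx; apply: card_le_trans Lx _; apply: subset_card_le.
by move=> y yx; apply: contrapT => ny; apply: nmin; exists y.
Qed.

Lemma small_segsS (L M : cardinal) : [set: L] #<= [set: M] ->
  small_segs L `<=` small_segs M.
Proof. by move=> LM x /card_lt_le_trans; apply. Qed.

End SmallSegs.

Theorem theorem4p1 (gch : GCH) (K : cardinal) (K_unc : ~ countable [set: K])
    (G : groupType) (G_ec : existentially_closed K G)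
    (G_card : [set: G] #= [set: K]) :
  let I := fun L : cardinal =>
    regular_cardinal L /\ [set: L] #<= [set: K] in
  exists Gs : cardinal -> groupClosed G,
    [/\ forall L M : cardinal, I L -> I M -> [set: L] #= [set: M] ->
          [set` Gs L] = [set` Gs M],
        [set 1%g] `<` [set` Gs nat],
        forall L M : cardinal, I L -> I M -> [set: L] #< [set: M] ->
          [set` Gs L] `<` [set` Gs M],
        forall x : G, exists L : cardinal, I L /\ x \in Gs L &
        [/\ forall L : cardinal, I L ->
              existentially_closed L (subgroup_type (Gs L)),
            forall L : cardinal, I L -> [set` Gs L] #= [set: L] &
            I K -> [set` Gs K] = [set: G]]].
Proof.
move=> I; have /card_eqPle[GK KG] := G_card.
have [R Rini] := initial_wo_exists G.
have /choice[Gs GsE] L :=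
  groupClosed_of_subgroup (hull_subgroup L (small_segs R L)).
have LG L : I L -> [set: L] #<= [set: G] by move=> [_ /card_le_trans]; apply.
have subGs L M : [set: L] #<= [set: M] -> [set` Gs L] `<=` [set` Gs M].
  by move=> LM; rewrite !GsE; apply: hullS => //; exact: small_segsS.
have leGs L : I L -> [set: L] #<= [set` Gs L].
  move=> IL; rewrite GsE.
  apply: card_le_trans (card_le_small_segs Rini (LG L IL)) _.
  by apply: subset_card_le; exact: sub_hull.
have Gsle L : I L -> [set` Gs L] #<= [set: L].
  move=> IL; have [Lreg _] := IL; have [iL _] := Lreg.
  rewrite GsE; apply: hull_card_le => //; first exact: small_segs_card_le.
  apply: infinite_setN0; apply: contra_not iL.
  exact: card_le_finite (card_le_small_segs Rini (LG L IL)).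
have natK : [set: nat] #<= [set: K].
  by have [//|/K_unc] := card_le_total [set: nat] [set: K].
have Inat : I nat by split=> //; exact: nat_regular.
exists Gs; split.
- move=> L M IL IM /card_eqPle[LM ML].
  by apply/seteqP; split; exact: subGs.
- split; first by move=> _ ->; exact: gpred1.
  move=> /subset_card_le le; apply: infinite_nat.
  apply: card_le_finite (finite_set1 (1%g : G)).
  exact: card_le_trans (leGs _ Inat) le.
- move=> L M IL IM /andP[LM /negP ML]; split; first exact: subGs.
  move=> /subset_card_le le; apply: ML.
  exact: card_le_trans (leGs _ IM) (card_le_trans le (Gsle _ IL)).
- move=> x; have [_ Rseg] := Rini.
  suff [L IL Lx] : exists2 L : cardinal, I L & small_segs R L x.
    exists L; split=> //; have : [set` Gs L] x by rewrite GsE; exact: sub_hull.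
    by [].
  have [fin|inf] := pselect (finite_set (seg R x)).
    exists nat => //.
    by apply: finite_infinite_card_lt => //; exact: infinite_nat.
  (* For an infinite segment below [x] the index is its power set: regular, larger than the segment,
     and at most [K], since otherwise [K] would lie strictly between the two. *)
  have /card_eqPle[AT TA] := card_setT (seg R x).
  have lt := card_lt_le_trans (card_le_lt_trans AT (Rseg x)) GK.
  have iA : infinite_set [set: seg R x] by move/(card_le_finite TA).
  exists (set (seg R x)); last exact: card_le_lt_trans TA (card_lt_powerset _).
  split; first exact: GCH_powerset_regular.
  by apply/card_leNgt => KP; apply: (gch (seg R x) K).
- split=> [L IL|L IL|IK].
  + have [[iL _] LK] := IL; apply: (sol_closed_existentially_closed G_ec) => //.
      exact: leGs.
    by rewrite GsE; exact: hull_sol_closed.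
  + by apply/card_eqPle; split; [exact: Gsle|exact: leGs].
  + apply/seteqP; split=> // x _; rewrite GsE; apply: sub_hull.
    by apply: card_lt_le_trans GK; case: Rini.
Qed.
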